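(* For positive integers $m$ and $k$, \[ t^{\star}(\{2m\}_k)=\frac{(-1)^{mk}}{(2mk)!}\left(\frac{\pi}{2}\right)^{2mk}\sum_{\substack{n_1+\cdots+n_m=mk\\ n_j\ge0}}\binom{2mk}{2n_1,\dots,2n_m}\prod_{j=1}^m e^{\frac{2\pi i}{m}(j-1)n_j}E_{2n_j}, \] where $\binom{2mk}{2n_1,\dots,2n_m}$ is a multinomial coefficient.
   Context: The $t$-star value is $t^{\star}(i_1,\dots,i_k)=\sum_{n_1\ge\cdots\ge n_k\ge1,\ n_j\text{ odd}}n_1^{-i_1}\cdots n_k^{-i_k}$ for $i_1\ge2$, and $\{2m\}_k$ denotes $2m$ repeated $k$ times. The Euler numbers $E_{2j}$ are defined by $\sec x=\sum_{j\ge0}\frac{(-1)^jE_{2j}}{(2j)!}x^{2j}$ (so $E_0=1$, $E_2=-1$, $E_4=5$, \dots). *)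

(* Defs.v *)
From HB Require Import structures.
From mathcomp Require Import all_boot all_order all_algebra.
From mathcomp Require Import all_classical all_reals all_analysis.
From mathcomp Require Import complex ring.

Set Implicit Arguments.
Unset Strict Implicit.
Unset Printing Implicit Defensive.

Import Order.TTheory GRing.Theory Num.Theory.
Import numFieldNormedType.Exports.

Local Open Scope classical_set_scope.
Local Open Scope ring_scope.
Local Open Scope complex_scope.

(* All terms are nonnegative, so the series is taken as an unordered sum in
   [0, +oo]; it is finite exactly when the t-star series converges. Odd numbers
   are automatically positive, hence no condition n_k >= 1 appears. *)
Definition tstar (R : realType) (k : nat) (s : k.-tuple nat) : \bar R :=
  \esum_(n in [set n : k.-tuple nat | sorted geq n && all odd n])
    (\prod_(j < k) ((tnth n j)%:R ^- tnth s j))%:E.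

(* E j is the Euler number of index j; only even indices are constrained. *)
Definition is_euler_numbers (R : realType) (E : nat -> R) : Prop :=
  \forall x \near (0 : R),
    series (fun j => (-1) ^+ j * E (2 * j)%N / ((2 * j)`!)%:R * x ^+ (2 * j))
      @ \oo --> (cos x)^-1.

Definition cexp (R : realType) (z : R[i]) : R[i] :=
  (expR (complex.Re z))%:C *
    (cos (complex.Im z) +i* sin (complex.Im z)).

(* Meaningful when the f j add up to n, in which case the division is exact. *)
Definition multinom (n m : nat) (f : 'I_m -> nat) : nat :=
  (n`! %/ \prod_(j < m) (f j)`!)%N.

(* Existence of the Euler numbers: the Taylor coefficients of sec, built by
   inverting the cosine series, sum to sec near 0. *)
Section EulerExistence.
Variable R : realType.

Let c (i : nat) : R := (-1) ^+ i / ((2 * i)`!)%:R.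

Let Fixpoint bs (n : nat) : seq R :=
  if n is n'.+1 then
    rcons (bs n') (if n' == 0%N then 1
                   else - \sum_(j < n') (bs n')`_j * c (n' - j))
  else [::].

Let b (n : nat) : R := (bs n.+1)`_n.

Let size_bs n : size (bs n) = n.
Proof. by elim: n => //= n IHn; rewrite size_rcons IHn. Qed.

Let nth_bs n j : (j < n)%N -> (bs n)`_j = b j.
Proof.
elim: n => // n IHn; rewrite ltnS leq_eqVlt => /orP[/eqP -> //|jn] /=.
by rewrite nth_rcons size_bs jn IHn.
Qed.

Let bE n : b n = if n == 0%N then 1 else - \sum_(j < n) b j * c (n - j).
Proof.
rewrite /b /= nth_rcons size_bs ltnn eqxx; case: eqP => // _.
by congr (- _); apply: eq_bigr => j _; rewrite nth_bs.
Qed.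

Let c0 : c 0 = 1. Proof. by rewrite /c expr0 muln0 fact0 divr1. Qed.

Let conv_bc n : \sum_(j < n.+1) b j * c (n - j) = (n == 0%N)%:R.
Proof.
rewrite big_ord_recr /= subnn c0 mulr1 [b n]bE.
by case: eqP => [->|_]; rewrite ?big_ord0 ?add0r // subrr.
Qed.

Let fact2_ge i : (2 ^ i <= (2 * i)`!)%N.
Proof.
elim: i => // i IHi; rewrite mulnS addSn addSn add0n !factS expnS.
rewrite mulnA; apply: leq_mul => //.
by rewrite -[X in (X <= _)%N]muln1; apply: leq_mul.
Qed.

Let norm_c i : `|c i| <= 2 ^- i.
Proof.
rewrite /c normrM normrX normrN1 expr1n mul1r normfV normr_nat.
by rewrite lef_pV2 ?posrE ?ltr0n ?fact_gt0 ?exprn_gt0 // -natrX ler_nat.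
Qed.

Let norm_c1 i : `|c i| <= 1.
Proof.
by apply: le_trans (norm_c i) _; rewrite invf_le1 ?exprn_gt0 // exprn_ege1 // ler1n.
Qed.

Let sum_half n : \sum_(j < n) (2 ^- (n - j)) <= 1 :> R.
Proof.
elim: n => [|n IHn]; first by rewrite big_ord0.
rewrite big_ord_recr /= subSnn expr1.
under eq_bigr => j _ do rewrite subSn ?(ltnW (ltn_ord j)) // exprS invfM.
rewrite -mulr_sumr [leRHS](_ : _ = 2^-1 * 1 + 2^-1); last first.
  by rewrite mulr1 -[2^-1]mul1r -splitr.
by rewrite lerD2r ler_wpM2l ?invr_ge0.
Qed.

Let norm_b n : `|b n| <= 1.
Proof.
elim/ltn_ind: n => n IHn; rewrite bE; case: eqP => [_|_]; first by rewrite normr1.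
rewrite normrN; apply: le_trans (ler_norm_sum _ _ _) _.
apply: le_trans (sum_half n); apply: ler_sum => j _.
rewrite normrM -[leRHS]mul1r; apply: ler_pM => //.
exact: IHn.
Qed.

Let prod_bound (y : R) N : 0 <= y <= 16^-1 ->
  `|(\sum_(i < N.+1) b i * y ^+ i) * (\sum_(i < N.+1) c i * y ^+ i) - 1|
    <= 2 * 4^-1 ^+ N.+1.
Proof.
move=> /andP[y0 y16].
set P := \poly_(i < N.+1) b i; set Q := \poly_(i < N.+1) c i.
have -> : \sum_(i < N.+1) b i * y ^+ i = P.[y] by rewrite horner_poly.
have -> : \sum_(i < N.+1) c i * y ^+ i = Q.[y] by rewrite horner_poly.
rewrite -hornerM (@horner_coef_wide _ (N.+1 + N.+1)); last first.
  apply: leq_trans (size_polyMleq _ _) _; apply: leq_trans (leq_pred _) _.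
  by apply: leq_add; exact: size_poly.
rewrite big_split_ord /= big_ord_recl /=.
have -> : (P * Q)`_0 = 1.
  by rewrite coefM big_ord1 subnn !coef_poly /= c0 mulr1 bE.
rewrite expr0 mulr1 [X in 1 + X + _]big1 => [|i _]; last first.
  rewrite coefM (_ : \sum_(_ < _) _ = 0) ?mul0r //.
  rewrite -[RHS](conv_bc (lift ord0 i)).
  apply: eq_bigr => j _; rewrite !coef_poly.
  have iN : (lift ord0 i <= N)%N by rewrite -ltnS.
  have jN : (j <= N)%N by apply: leq_trans iN; rewrite -ltnS.
  by rewrite !ltnS jN (leq_trans (leq_subr _ _) iN).
rewrite addr0 addrAC subrr add0r.
apply: le_trans (ler_norm_sum _ _ _) _.
have term (i : 'I_N.+1) : `|(P * Q)`_(N.+1 + i) * y ^+ (N.+1 + i)|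
    <= 2 * N.+1%:R * 16^-1 ^+ N.+1.
  rewrite normrM; apply: ler_pM => //.
    rewrite coefM; apply: le_trans (ler_norm_sum _ _ _) _.
    apply: (@le_trans _ _ (\sum_(j < (N.+1 + i).+1) 1)).
      apply: ler_sum => j _; rewrite normrM -[leRHS]mul1r.
      by apply: ler_pM => //; rewrite coef_poly; case: ifP; rewrite ?normr0.
    rewrite sumr_const card_ord -natrM ler_nat mul2n -addnn -addnS leq_add2l.
    exact: ltn_ord.
  rewrite ger0_norm ?exprn_ge0 // exprD -[leRHS]mulr1.
  apply: ler_pM; rewrite ?exprn_ge0 ?lerXn2r ?nnegrE ?invr_ge0 //.
  by rewrite exprn_ile1 // (le_trans y16) // invf_le1 // ler1n.
apply: le_trans (ler_sum _ (fun i _ => term i)) _.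
rewrite sumr_const card_ord -[_ *+ _]mulr_natr.
have -> : (16^-1 : R) = 4^-1 * 4^-1 by rewrite -invfM -natrM.
rewrite exprMn; set a := 4^-1 ^+ N.+1; set n : R := N.+1%:R.
have nna : n * n * a <= 1.
  rewrite /a exprVn ler_pdivrMr ?exprn_gt0 // mul1r.
  rewrite -natrM -natrX ler_nat -[4%N]/(2 * 2)%N expnMn.
  by apply: leq_mul; exact/ltnW/ltn_expl.
have a0 : 0 <= a by rewrite exprn_ge0 ?invr_ge0.
rewrite (_ : _ * n = 2 * a * (n * n * a)); last by ring.
by rewrite ler_piMr // mulr_ge0.
Qed.

Lemma euler_numbers_exist : exists E : nat -> R, is_euler_numbers E.
Proof.
exists (fun n => (-1) ^+ n./2 * n`!%:R * b n./2).
have near4 : \forall x \near (0 : R), `|x| <= 4^-1.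
  by apply: (@nbhs0_le R R^o); rewrite invr_gt0.
apply: filterS near4 => x x4.
set u := (fun j : nat => _).
have uE : u = (fun j => b j * (x ^+ 2) ^+ j).
  apply/funext => j; rewrite /u mul2n doubleK -exprM -mul2n; congr (_ * _).
  rewrite !mulrA -exprD addnn -signr_odd odd_double expr0 mul1r.
  by rewrite mulrAC divff ?mul1r // pnatr_eq0 -lt0n fact_gt0.
have y0 : 0 <= x ^+ 2 by exact: sqr_ge0.
have y16 : x ^+ 2 <= 16^-1.
  rewrite -real_normK ?num_real // (_ : 16^-1 = 4^-1 ^+ 2).
    by rewrite lerXn2r ?nnegrE ?invr_ge0.
  by rewrite exprVn -natrX.
have cu : cvgn (series u).
  apply: normed_cvg; apply: (@series_le_cvg _ _ (geometric 1 (x ^+ 2))).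
  - by move=> n; exact: normr_ge0.
  - by move=> n; rewrite /= mul1r exprn_ge0.
  - move=> n; rewrite uE /= normrM; apply: ler_pM => //.
    by rewrite (ger0_norm (exprn_ge0 n y0)).
  - apply: is_cvg_geometric_series; rewrite ger0_norm //.
    by apply: le_lt_trans y16 _; rewrite invf_lt1 // ltr1n.
have cc := @cvg_cos_coeff' R x.
have ccE : series (cos_coeff' x) = series (fun j => c j * (x ^+ 2) ^+ j).
  congr series; apply/funext => j.
  by rewrite /cos_coeff' /c -exprM -mul2n mulrAC.
have prod1 : (series u n.+1 * series (cos_coeff' x) n.+1) @[n --> \oo] --> (1 : R).
  apply/subr_cvg0; apply/norm_cvg0P.
  apply: (@squeeze_cvgr _ _ _ _ (fun=> 0) (fun n => 2 * 4^-1 ^+ n.+1)).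
  - apply: nearW => n; rewrite normr_ge0 /= uE ccE /series /= !big_mkord.
    by apply: prod_bound; rewrite y0.
  - exact: cvg_cst.
  - rewrite -(mulr0 2); apply: cvgMr.
    rewrite (cvg_shiftS (fun n => (4^-1 : R) ^+ n)).
    by apply: cvg_expr; rewrite ger0_norm ?invr_ge0 // invf_lt1 // ltr1n.
have cuc : (series u \* series (cos_coeff' x)) @ \oo --> limn (series u) * cos x.
  exact: cvgM cu cc.
rewrite -(cvg_shiftS (series u \* series (cos_coeff' x))) in cuc.
have sc : limn (series u) * cos x = 1.
  by rewrite -(cvg_lim (@Rhausdorff R) cuc) -(cvg_lim (@Rhausdorff R) prod1).
suff -> : (cos x)^-1 = limn (series u) by [].
have cos_neq0 : cos x != 0.
  by apply/eqP => c00; move: sc; rewrite c00 mulr0 => /eqP; rewrite eq_sym oner_eq0.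
by apply: (mulIf cos_neq0); rewrite mulVf // sc.
Qed.

End EulerExistence.

(* Main.v *)
(** With y_i = (2i+1)^-2, the t-star value t*({2m}_k) is the limit in N of the
complete homogeneous symmetric polynomial h_k(y_0^m, ..., y_(N-1)^m).

For m = 1 the generating function of these polynomials is the inverse of the
Euler product prod_i (1 - x^2 y_i) = cos(pi x/2), so h_n(y_0, ..., y_(N-1))
tends to the coefficient of x^(2n) in sec(pi x/2), which is given by E_(2n). The Euler
product comes from the Wallis integrals
I_n(x) = int_0^(pi/2) cos(x t) cos^n t dt: integration by parts gives
(n^2 - x^2) I_n(x) = n (n-1) I_(n-2)(x), and I_n(x) / I_n(0) tends to 1.

For general m, with z = exp(2 pi i/m), the factorization
1 - y^m X^m = prod_(j<m) (1 - z^j y X) expresses h_k(y^m) as a sum of products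
of the z^(j n_j) h_(n_j)(y) with sum_j n_j = mk; this identity holds for each N
and passes to the limit. *)

Require Import Defs.
From HB Require Import structures.
From mathcomp Require Import all_boot all_order all_algebra.
From mathcomp Require Import all_classical all_reals all_analysis.
From mathcomp Require Import complex ring lra zify.

Set Implicit Arguments.
Unset Strict Implicit.
Unset Printing Implicit Defensive.

Import Order.TTheory GRing.Theory Num.Theory.
Import numFieldNormedType.Exports.

Local Open Scope classical_set_scope.
Local Open Scope ring_scope.
Local Open Scope complex_scope.

(** * Complete homogeneous symmetric polynomials *)

(** A monomial of positive degree in the first N'+1 variables either avoids [a N'] or is [a N']
    times a monomial of degree one less in the same variables, hence the inner recursion on [k] at
    fixed N. *)
Fixpoint hsym (A : comNzRingType) (a : nat -> A) (N : nat) : nat -> A :=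
  if N is N'.+1 then
    fix h (k : nat) : A :=
      if k is k'.+1 then hsym a N' k'.+1 + a N' * h k' else 1
  else fun k => (k == 0%N)%:R.

Section CompleteHomogeneous.
Variable A : comNzRingType.
Implicit Type a : nat -> A.

Lemma hsym0 a N : hsym a N 0 = 1.
Proof. by case: N. Qed.

Lemma hsymS a N k : hsym a N.+1 k.+1 = hsym a N k.+1 + a N * hsym a N.+1 k.
Proof. by []. Qed.

Lemma hsymZ (c : A) a N k :
  hsym (fun i => c * a i) N k = c ^+ k * hsym a N k.
Proof.
elim: N k => [|N IHN]; first by case=> [|k]; rewrite /= ?expr0 ?mulr1 ?mulr0.
elim=> [|k IHk]; first by rewrite !hsym0 mulr1.
by rewrite !hsymS IHN IHk exprS; ring.
Qed.

End CompleteHomogeneous.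

Lemma hsym_morph (A B : comNzRingType) (f : {rmorphism A -> B}) a N k :
  f (hsym a N k) = hsym (f \o a) N k.
Proof.
elim: N k => [|N IHN]; first by move=> k; rewrite /= rmorph_nat.
by elim=> [|k IHk]; rewrite ?hsym0 ?rmorph1 // !hsymS rmorphD rmorphM IHN IHk.
Qed.

(** Congruence modulo [X^M] stands in for equality of power series: it suffices for reading off a
    single coefficient. *)
Definition eqmodX (A : comNzRingType) (M : nat) (p q : {poly A}) :=
  forall i, (i < M)%N -> p`_i = q`_i.

Section EqmodX.
Variables (A : comNzRingType) (M : nat).
Implicit Types p q : {poly A}.

Lemma eqmodXM p p' q q' :
  eqmodX M p p' -> eqmodX M q q' -> eqmodX M (p * q) (p' * q').
Proof.
move=> pp' qq' i iM; rewrite !coefM; apply: eq_bigr => j _.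
rewrite pp' ?qq' //; first exact: leq_ltn_trans (leq_subr _ _) iM.
by apply: leq_trans iM; rewrite ltn_ord.
Qed.

Lemma eqmodX_prod1 (I : finType) (p : I -> {poly A}) :
  (forall i, eqmodX M (p i) 1) -> eqmodX M (\prod_i p i) 1.
Proof.
move=> p1; apply: (big_ind (fun q => eqmodX M q 1)) => // q r q1 r1.
by rewrite -(mulr1 1); apply: eqmodXM.
Qed.

(** Modulo [X^M], q = q (p r) = (p q) r = r. *)
Lemma eqmodX_inv_uniq p q r :
  eqmodX M (p * q) 1 -> eqmodX M (p * r) 1 -> eqmodX M q r.
Proof.
move=> pq pr i iM; rewrite -[q]mulr1 -(@eqmodXM q q (p * r) 1) //.
rewrite mulrA [q * p]mulrC (@eqmodXM (p * q) 1 r r) //.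
by rewrite mul1r.
Qed.

End EqmodX.

Section HsymGenerating.
Variables (A : comNzRingType) (M : nat).
Implicit Types (a : nat -> A) (q : {poly A}).

(** By [hsymS], multiplication by [1 - a_N X] removes the last variable from the generating
    function. Only the coefficients of [p] below M are prescribed, so the induction hypothesis
    applies to [(1 - a_N X) p] as it stands. *)
Lemma eqmodX_hsym a N (p : {poly A}) :
    (forall i, (i < M)%N -> p`_i = hsym a N i) ->
  eqmodX M (\prod_(i < N) (1 - (a i) *: 'X) * p) 1.
Proof.
elim: N p => [|N IHN] p pE.
  by move=> i iM; rewrite big_ord0 mul1r pE // coef1.
rewrite big_ord_recr /= -mulrA; apply: IHN => i iM.
rewrite mulrBl mul1r -scalerAl coefB coefZ coefXM pE //.
case: i iM => [|i] iM; first by rewrite !hsym0 mulr0 subr0.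
by rewrite pE ?hsymS ?(ltnW iM) //= addrK.
Qed.

(** The same telescoping in the variable [X^m]: only exponents divisible by m carry a
    coefficient. *)
Lemma eqmodX_hsym_pow a N m (p : {poly A}) : (0 < m)%N ->
    (forall i, (i < M)%N -> p`_i = if (m %| i)%N then hsym a N (i %/ m) else 0) ->
  eqmodX M (\prod_(i < N) (1 - (a i) *: 'X^m) * p) 1.
Proof.
move=> m0; elim: N p => [|N IHN] p pE.
  move=> i iM; rewrite big_ord0 mul1r pE // coef1.
  case: i {iM} => [|i]; first by rewrite dvdn0 div0n.
  case: ifP => // mi.
  by rewrite /= -leqn0 leqNgt divn_gt0 // dvdn_leq.
rewrite big_ord_recr /= -mulrA; apply: IHN => i iM.
rewrite mulrBl mul1r -scalerAl coefB coefZ coefXnM pE //.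
case: ltnP => [im|mi].
  rewrite mulr0 subr0; case: ifP => // /dvdnP[[|j] ij].
    by rewrite ij mul0n div0n !hsym0.
  by move: im; rewrite ij mulSn ltnNge leq_addr.
rewrite pE ?(leq_ltn_trans (leq_subr _ _) iM) //.
have -> : (m %| i - m)%N = (m %| i)%N by rewrite dvdn_subl.
case: ifP => mdi; last by rewrite mulr0 subr0.
have -> : (i %/ m = ((i - m) %/ m).+1)%N.
  by rewrite -{1}(subnK mi) divnDr ?dvdnn // divnn m0 addn1.
by rewrite hsymS addrK.
Qed.

End HsymGenerating.

(** * Factorization over roots of unity *)

Section PrimitiveRoot.
Variables (F : fieldType) (m : nat) (z : F).
Hypothesis zP : m.-primitive_root z.

Lemma prim_rootV : m.-primitive_root z^-1.
Proof.
case/andP: zP => m0 /forallP zA; rewrite /primitive_root_of_unity m0.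
by apply/forallP => i; rewrite -(eqP (zA i)) !unity_rootE exprVn invr_eq1.
Qed.

Lemma prod_1subX_prim : \prod_(j < m) (1 - z ^+ j *: 'X) = 1 - 'X^m.
Proof.
have m0 := prim_order_gt0 zP.
have z0 : z != 0.
  apply/eqP => z0; move: (prim_expr_order zP).
  by rewrite z0 expr0n eqn0Ngt m0 => /esym/eqP; rewrite oner_eq0.
(* Since 1 - z^j X = - z^j (X - z^(-j)), the roots are the powers of [z^-1]. The constant [c] is
   read off at X = 0 instead of being computed. *)
have [c pE] : exists c : F,
    \prod_(j < m) (1 - z ^+ j *: 'X) = c *: ('X^m - 1) :> {poly F}.
  rewrite -(factor_Xn_sub_1 prim_rootV) big_mkord.
  exists (\prod_(j < m) (- z ^+ j)).
  rewrite -scaler_prod; apply: eq_bigr => j _.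
  rewrite scalerBr !scaleNr opprK addrC exprVn -[_ *: _%:P]mul_polyC -polyCM.
  by rewrite mulfV ?expf_neq0.
have := congr1 (fun p : {poly F} => p.[0]) pE.
rewrite hornerZ hornerD hornerN hornerXn hornerC expr0n eqn0Ngt m0 /= sub0r.
rewrite horner_prod big1 => [|j _]; last first.
  by rewrite !hornerE subr0.
rewrite pE mulrN1 => /(congr1 -%R); rewrite opprK => <-.
by rewrite scaleN1r opprB.
Qed.

Lemma prod_1subX_primZ (b : F) :
  \prod_(j < m) (1 - (z ^+ j * b) *: 'X) = 1 - (b ^+ m) *: 'X^m.
Proof.
have := congr1 (fun p : {poly F} => p \Po (b *: 'X)) prod_1subX_prim.
rewrite comp_polyB comp_polyC comp_Xn_poly exprZn => <-.
rewrite rmorph_prod; apply: eq_bigr => j _ /=.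
by rewrite comp_polyB comp_polyC comp_polyZ comp_polyX scalerA.
Qed.

(* prod_i 1/(1 - a_i^m X^m) = prod_j prod_i 1/(1 - z^j a_i X), read off at
   X^(mk). *)
Lemma hsym_prim (a : nat -> F) N k :
  hsym (fun i => a i ^+ m) N k =
  \sum_(n : {ffun 'I_m -> 'I_(m * k).+1} | (\sum_(j < m) n j == m * k)%N)
    \prod_(j < m) (z ^+ j) ^+ n j * \prod_(j < m) hsym a N (n j).
Proof.
set M := (m * k).+1; have m0 := prim_order_gt0 zP.
pose H (j : 'I_m) : {poly F} := \poly_(i < M) hsym (fun i => z ^+ j * a i) N i.
pose G : {poly F} :=
  \poly_(i < M) if (m %| i)%N then hsym (fun i => a i ^+ m) N (i %/ m) else 0.
pose P : {poly F} := \prod_(i < N) (1 - (a i ^+ m) *: 'X^m).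
have PG : eqmodX M (P * G) 1.
  apply: (@eqmodX_hsym_pow _ _ (fun i => a i ^+ m)) => // i iM.
  by rewrite coef_poly iM.
have PH : eqmodX M (P * \prod_j H j) 1.
  have -> : P = \prod_(j < m) \prod_(i < N) (1 - (z ^+ j * a i) *: 'X).
    rewrite /P exchange_big /=; apply: eq_bigr => i _.
    by rewrite prod_1subX_primZ.
  rewrite -big_split /=; apply: eqmodX_prod1 => j.
  apply: (@eqmodX_hsym _ _ (fun i => z ^+ j * a i)) => i iM.
  by rewrite coef_poly iM.
(* [G] and [\prod_j H j] both invert [P] modulo [X^M], so their coefficients at X^(mk) agree; M = mk
   + 1 just reaches this degree. *)
have := eqmodX_inv_uniq PG PH (ltnSn (m * k)).
rewrite coef_poly ltnSn dvdn_mulr // mulKn // => ->.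
under eq_bigr => j _ do rewrite /H poly_def.
rewrite bigA_distr_bigA coef_sum /= [RHS]big_mkcond /=.
apply: eq_bigr => f _.
rewrite scaler_prod -[\prod_(i < m) 'X^(f i)](expr_sum) coefZ coefXn eq_sym.
case: eqP => _; rewrite ?mulr1 ?mulr0 // -big_split.
by apply: eq_bigr => j _; rewrite hsymZ.
Qed.

End PrimitiveRoot.
Arguments hsym : simpl never.

(** * Unordered sums over nonincreasing odd tuples *)

(** Induction through (a + b)! = C(a + b, a) a! b!. This makes the truncating division in [multinom]
    exact. *)
Lemma dvdn_prod_fact (I : Type) (s : seq I) (f : I -> nat) :
  (\prod_(j <- s) (f j)`! %| (\sum_(j <- s) f j)`!)%N.
Proof.
elim: s => [|j s IHs]; first by rewrite !big_nil.
rewrite !big_cons -(@bin_fact (f j + _) (f j)) ?leq_addr // addKn.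
by apply: dvdn_mull; apply: dvdn_mul.
Qed.

Lemma multinomE (F : numFieldType) (n m : nat) (f : 'I_m -> nat) :
    (\sum_(j < m) f j = n)%N ->
  (multinom n f)%:R = n`!%:R * \prod_(j < m) (f j)`!%:R^-1 :> F.
Proof.
move=> fn; have p0 : (\prod_(j < m) (f j)`!)%:R != 0 :> F.
  by rewrite pnatr_eq0 -lt0n prodn_gt0 // => j; rewrite fact_gt0.
rewrite prodfV -natr_prod; apply: (mulIf p0); rewrite divfK // -natrM divnK //.
by rewrite -fn dvdn_prod_fact.
Qed.

Section HsymReal.
Variables (R : numDomainType) (a : nat -> R).
Hypothesis a0 : forall i, 0 <= a i.

Lemma hsym_ge0 N k : 0 <= hsym a N k.
Proof.
elim: N k => [k|N IHN]; first exact: ler0n.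
by elim=> [|k IHk]; rewrite ?hsym0 // hsymS addr_ge0 // mulr_ge0.
Qed.

Lemma nondecreasing_hsym k : nondecreasing_seq (fun N => hsym a N k).
Proof.
apply/nondecreasing_seqP => N; case: k => [|k]; first by rewrite !hsym0.
by rewrite hsymS lerDl mulr_ge0 // hsym_ge0.
Qed.

End HsymReal.

(** Enumerates nonincreasing sequences of k odd numbers below 2N by the recursion of [hsym]: either
    every entry is below 2N', or the head is 2N'+1 and the tail obeys the same bound as the
    whole. *)
Fixpoint odd_seqs (N : nat) : nat -> seq (seq nat) :=
  if N is N'.+1 then
    fix h (k : nat) :=
      if k is k'.+1 then odd_seqs N' k'.+1 ++ map (cons (2 * N').+1) (h k')
      else [:: [::]]
  else fun k => if k is _.+1 then [::] else [:: [::]].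

Lemma odd_seqs0 N : odd_seqs N 0 = [:: [::]].
Proof. by case: N. Qed.

Lemma odd_seqsS N k : odd_seqs N.+1 k.+1 =
  odd_seqs N k.+1 ++ map (cons (2 * N).+1) (odd_seqs N.+1 k).
Proof. by []. Qed.

Lemma mem_odd_seqs N k (s : seq nat) : (s \in odd_seqs N k) =
  [&& size s == k, sorted geq s, all odd s & all (fun i => i < 2 * N)%N s].
Proof.
have geq_trans : transitive geq by move=> y x z /= xy yz; apply: leq_trans xy.
elim: N k s => [|N IHN] k s.
  by case: k => [|k]; case: s => [|x s] //=; rewrite !andbF.
elim: k s => [|k IHk] s.
  by rewrite odd_seqs0 inE; case: s => [|x s].
rewrite odd_seqsS mem_cat IHN.
case: s => [|x s]; first by rewrite /=; apply/mapP => -[].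
have mem_consE : (x :: s \in map (cons (2 * N).+1) (odd_seqs N.+1 k)) =
    (x == (2 * N).+1) && (s \in odd_seqs N.+1 k).
  apply/mapP/andP => [[t tk [-> ->]]|[/eqP -> sk]]; first by rewrite eqxx.
  by exists s.
rewrite mem_consE IHk /= eqSS !path_sortedE //.
case: eqP => // _; last by rewrite andbF.
case: (sorted geq s); rewrite ?andbF //= !andbT.
case: (boolP (all odd s)) => sodd; rewrite ?andbF //=.
(* A head 2N+1 dominates every tail bounded by 2(N+1), so a tail not dominated by [x] excludes
   it. *)
case: (boolP (all (geq x) s)) => xs; rewrite /= ?andbF //=; last first.
  apply/negbTE; apply: contra xs => /andP[/eqP -> /allP s2]; apply/allP => i si.
  have := s2 i si; have := allP sodd i si => /=; lia.
case: eqP => [->|xN] /=.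
  have -> : ((2 * N).+1 < 2 * N)%N = false by lia.
  have -> : ((2 * N).+1 < 2 * N.+1)%N by lia.
  by rewrite oddM andbF.
(* An odd head below 2(N+1) other than 2N+1 is below 2N, and it bounds the tail. *)
rewrite orbF andbT; case: (boolP (odd x)) => //= xodd.
apply/andP/andP => -[x2 /allP s2]; split; try lia; apply/allP => i si.
  by have := s2 i si => /=; lia.
by have := allP xs i si => /=; lia.
Qed.

Lemma uniq_odd_seqs N k : uniq (odd_seqs N k).
Proof.
elim: N k => [|N IHN]; first by case.
elim=> [|k IHk] //; rewrite odd_seqsS cat_uniq IHN map_inj_uniq ?IHk ?andbT /=.
  apply/hasPn => s /mapP[t _ ->]; rewrite mem_odd_seqs /= !negb_and.
  by rewrite [in X in [|| _, _, _ | X]]ltnNge leqnSn !orbT.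
by move=> s t [].
Qed.

Lemma sum_odd_seqs (A : comNzRingType) (g : nat -> A) N k :
  \sum_(s <- odd_seqs N k) \prod_(i <- s) g i =
  hsym (fun i => g (2 * i).+1) N k.
Proof.
elim: N k => [|N IHN]; first
  by case=> [|k]; rewrite /= ?big_nil // big_seq1 big_nil.
elim=> [|k IHk]; first by rewrite odd_seqs0 big_seq1 big_nil.
rewrite odd_seqsS hsymS big_cat IHN big_map -IHk big_distrr /=; congr (_ + _).
by apply: eq_bigr => s _; rewrite big_cons.
Qed.


Section EsumOddTuples.
Variables (R : realType) (k : nat) (g : nat -> R).
Hypothesis g0 : forall i, 0 <= g i.

Let S := [set n : k.-tuple nat | sorted geq n && all odd n].
Let F (n : k.-tuple nat) := (\prod_(j < k) g (tnth n j))%:E.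
Let X N := [set` pmap insub (odd_seqs N k) : seq (k.-tuple nat)].

Let XE N t : X N t <-> (t : seq nat) \in odd_seqs N k.
Proof. by rewrite /X /= mem_pmap_sub. Qed.

Let sub_XS N : X N `<=` S.
Proof.
by move=> t /XE; rewrite mem_odd_seqs => /and4P[_ ? ? _]; apply/andP.
Qed.

Let F0 t : (0 <= F t)%E.
Proof. by rewrite lee_fin prodr_ge0. Qed.

Let sum_X N : (\sum_(t \in X N) F t)%E = (hsym (fun i => g (2 * i).+1) N k)%:E.
Proof.
rewrite -fsbig_seq; last by rewrite pmap_sub_uniq // uniq_odd_seqs.
rewrite -sum_odd_seqs sumEFin; congr (_%:E).
have valX :
    map val (pmap insub (odd_seqs N k) : seq (k.-tuple nat)) = odd_seqs N k.
  rewrite (pmap_filter (insubK _)); apply/all_filterP/allP => s.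
  by rewrite mem_odd_seqs isSome_insub => /andP[].
rewrite -[in RHS]valX big_map.
by apply: eq_bigr => t _; rewrite big_tuple.
Qed.

(** The finite sets [X N] exhaust S: every finite subset of S lies in one of them. As the terms are
    nonnegative, the unordered sum is the limit of the sums over [X N], which are the [hsym]
    values. *)
Lemma esum_odd_tuples (l : R) :
    (hsym (fun i => g (2 * i).+1) N k @[N --> \oo] --> l) ->
  \esum_(n in S) F n = l%:E.
Proof.
move=> hl; apply/eqP; rewrite eq_le; apply/andP; split.
  apply: ge_ereal_sup => _ [Y [finY YS] <-].
  have [r rY] := (finite_seqP Y).1 finY.
  (* One more than the sum of all entries of all tuples of [Y], so it exceeds each entry. *)
  pose N := (\sum_(t <- r) sumn t).+1.
  have YX : Y `<=` X N.
    move=> t Yt; apply/XE; rewrite mem_odd_seqs size_tuple eqxx /=.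
    have /andP[-> ->] /= := YS _ Yt.
    apply/allP => i it /=.
    have : (i <= sumn t)%N.
      by rewrite sumnE (big_rem i it) /= leq_addr.
    have : (sumn t <= \sum_(t <- r) sumn t)%N.
      move: Yt; rewrite rY /= => tr.
      by rewrite (big_rem t tr) /= leq_addr.
    by rewrite /N; lia.
  apply: (@le_trans _ _ (\sum_(t \in X N) F t)%E).
    apply: lee_fsum_nneg_subset => //.
      exact: finite_seq.
    by move=> t; rewrite !inE; apply: YX.
  rewrite sum_X lee_fin.
  have nd := @nondecreasing_hsym _ (fun i => g (2 * i).+1) (fun i => g0 _) k.
  have := nondecreasing_cvgn_le nd.
  move=> /(_ (cvgP _ hl) N).
  by rewrite (cvg_lim _ hl).
have hN N : ((hsym (fun i => g (2 * i).+1) N k)%:E <= \esum_(n in S) F n)%E.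
  rewrite -sum_X; apply: esum_ge; exists (X N) => //.
  by split; [exact: finite_seq|exact: sub_XS].
case: (\esum_(n in S) F n) hN => [s| |] hN; rewrite ?leey //; last first.
  by have := hN 0%N; rewrite leeNy_eq.
rewrite lee_fin -(cvg_lim _ hl) //; apply: limr_le; first exact: cvgP hl.
by apply: nearW => N; have := hN N; rewrite lee_fin.
Qed.

End EsumOddTuples.

Lemma tstar_nseq (R : realType) (k p : nat) (l : R) :
    (hsym (fun i => (2 * i).+1%:R ^- p) N k @[N --> \oo] --> l) ->
  tstar R (nseq_tuple k p) = l%:E.
Proof.
move=> hl; rewrite -(@esum_odd_tuples R k (fun i => i%:R ^- p) _ l hl).
  by apply: eq_esum => n _; under eq_bigr => j _ do rewrite tnth_nseq.
by move=> i; rewrite invr_ge0 exprn_ge0.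
Qed.

(** * The Euler product of the cosine *)

Definition wallis (R : realType) (N : nat) : R :=
  \prod_(i < N) ((2 * i).+2%:R / (2 * i).+3%:R).

Definition cosprod (R : realType) (x : R) (N : nat) : R :=
  \prod_(i < N) (1 - x ^+ 2 * (2 * i).+1%:R ^- 2).

Section TrigBounds.
Variable R : realType.
Implicit Types t x y : R.

(** The inequalities below are obtained by applying this to a difference that vanishes at 0. *)
Lemma le_is_derive_ge0 (f f' : R -> R) (a b : R) :
    (forall t, is_derive t 1 f (f' t)) ->
    (forall t, a < t < b -> 0 <= f' t) ->
  a <= b -> f a <= f b.
Proof.
move=> df f'0 ab; apply: (@ger0_derive1_ndecr _ f a b) => //.
- by move=> t; rewrite in_itv derive1E => /f'0; have [_ ->] := df t.
- by apply: derivable_within_continuous => t _; have [] := df t.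
Qed.

Lemma sin_le_id y : 0 <= y -> sin y <= y.
Proof.
move=> y0; rewrite -subr_ge0 -[leLHS](subrr (sin (0 : R))) {1}sin0.
apply: (@le_is_derive_ge0 (fun t => t - sin t) (fun t => 1 - cos t)) => //.
Qed.

Lemma cos_ge_quadratic y : 0 <= y -> 1 - cos y <= y ^+ 2 / 2.
Proof.
move=> y0; rewrite -subr_ge0.
have <- : 0 ^+ 2 / 2 - (1 - cos 0) = 0 :> R by rewrite cos0; field.
apply: (@le_is_derive_ge0 (fun t => t ^+ 2 / 2 - (1 - cos t))
  (fun t => t - sin t)) => //.
  by move=> t; apply: is_derive_eq; rewrite /GRing.scale /=; field.
by move=> t /andP[t0 _]; rewrite subr_ge0 sin_le_id // ltW.
Qed.

Lemma mul_cos_le_sin t : 0 <= t <= pi / 2 -> t * cos t <= sin t.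
Proof.
move=> /andP[t0 tpi]; rewrite -subr_ge0.
have <- : sin 0 - 0 * cos 0 = 0 :> R by rewrite sin0; ring.
apply: (@le_is_derive_ge0 (fun t => sin t - t * cos t) (fun t => t * sin t)) => //.
  by move=> s; apply: is_derive_eq; rewrite /GRing.scale /=; ring.
move=> s /andP[s0 st]; rewrite mulr_ge0 ?(ltW s0) // sin_ge0_pi //.
rewrite (ltW s0) /=; apply: le_trans (le_trans (ltW st) tpi) _.
by have := @pi_gt0 R; lra.
Qed.

Let is_derive_cosZ x t :
  is_derive t 1 (fun t => cos (x * t)) (- (x * sin (x * t))).
Proof.
apply: is_derive_eq (@is_derive1_comp _ cos (fun t => x * t) _ _ _ _ _) _.
by rewrite /GRing.scale /=; ring.
Qed.

Let is_derive_sinZ x t :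
  is_derive t 1 (fun t => sin (x * t)) (x * cos (x * t)).
Proof.
apply: is_derive_eq (@is_derive1_comp _ sin (fun t => x * t) _ _ _ _ _) _.
by rewrite /GRing.scale /=; ring.
Qed.

Let is_derive_cosX n t :
  is_derive t 1 (fun t => cos t ^+ n) (- (n%:R * cos t ^+ n.-1 * sin t)).
Proof.
have := @is_deriveX _ _ (@cos R) n t 1 _ (is_derive_cos t).
by rewrite exprfctE => /is_derive_eq; apply; rewrite /GRing.scale /= mulrN.
Qed.

#[local] Existing Instances is_derive_cosZ is_derive_sinZ is_derive_cosX.

(* Integrating this derivative over [0, pi/2] relates the integrals of
   cos (x t) cos^n t for n and n - 2. *)
Lemma is_derive_wallis x t n :
  is_derive t 1
    (fun t => n.+1%:R * cos (x * t) * cos t ^+ n * sin t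
              - x * sin (x * t) * cos t ^+ n.+1)
    (cos (x * t) * ((n.+1%:R ^+ 2 - x ^+ 2) * cos t ^+ n.+1
                    - n.+1%:R * n%:R * cos t ^+ n.-1)).
Proof.
apply: is_derive_eq; rewrite /GRing.scale /=.
have s2 := sin2cos2 t.
(* At n = 0 the truncated exponent [n.-1] is harmless, because its term carries the factor n. *)
case: n => [|n] /=; rewrite ?exprS; ring: s2.
Qed.
Lemma wallis_gt0 N : 0 < wallis R N.
Proof. by apply: prodr_gt0 => i _; rewrite divr_gt0. Qed.

(* A (pi/2) is the Wallis integral I_(2N+1)(x), and wallis R N is I_(2N+1)(0). *)
Lemma wallis_primitive x N : x ^+ 2 < 1 ->
  exists A : R -> R,
    [/\ forall t, is_derive t 1 A (cos (x * t) * cos t ^+ (2 * N).+1),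
        A 0 = 0
      & A (pi / 2) * cosprod x N.+1 = wallis R N * cos (x * (pi / 2))].
Proof.
move=> x1.
(* The boundary term of the integration by parts. It vanishes at 0 through the sines and, for n > 0,
   at pi/2 through the cosines. *)
pose G n t := n.+1%:R * cos (x * t) * cos t ^+ n * sin t
              - x * sin (x * t) * cos t ^+ n.+1 : R.
have G0 n : G n 0 = 0 by rewrite /G sin0 mulr0 mulr0 sin0; ring.
have denom_neq0 n : n.+1%:R ^+ 2 - x ^+ 2 != 0.
  rewrite subr_eq0 gt_eqF // (lt_le_trans x1) // -natrX ler1n expn_gt0.
  by [].
elim: N => [|N [A [dA A0 AE]]].
  have d0 : 1 - x ^+ 2 != 0 by have := denom_neq0 0%N; rewrite expr1n.
  (* [d] is 1/(1 - x^2), kept abstract with one polynomial relation that [ring] can use. *)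
  have [d dK] : exists d : R, d * x ^+ 2 = d - 1.
    by exists (1 - x ^+ 2)^-1; field.
  exists (fun t => d * G 0%N t); split => [t||].
  - have dG := is_derive_wallis x t 0.
    apply: is_derive_eq (is_deriveM (is_derive_cst d _ _) dG) _.
    by rewrite /cst /GRing.scale /= muln0; ring: dK.
  - by rewrite G0 mulr0.
  - rewrite /G cos_pihalf sin_pihalf /cosprod /wallis big_ord1 big_ord0 /= muln0.
    have v1 : 1%:R ^- 2 = 1 :> R by rewrite expr1n invr1.
    by rewrite v1; ring: dK.
set n := (2 * N).+2; have d0 := denom_neq0 n.
have [d dK] : exists d : R, d * x ^+ 2 = d * n.+1%:R ^+ 2 - 1.
  by exists (n.+1%:R ^+ 2 - x ^+ 2)^-1; field.
(* Solves ((n+1)^2 - x^2) I_(n+1) = (n+1) n I_(n-1) for n + 1 = 2N + 3, with [A] the primitive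
   belonging to I_(n-1). *)
exists (fun t => d * (G n t + n.+1%:R * n%:R * A t)).
have En : (2 * N.+1).+1 = n.+1 by rewrite /n mulnS.
split => [t||].
- have dG : is_derive t 1 (G n) _ := is_derive_wallis x t n.
  have dAt := dA t; apply: is_derive_eq.
  by rewrite /cst /GRing.scale En /=; ring: dK.
- by rewrite G0 A0 mulr0 addr0 mulr0.
- rewrite /G cos_pihalf {1}/n expr0n expr0n /= !(mulr0, mul0r) subrr add0r.
  rewrite /cosprod big_ord_recr /= -/(cosprod x N.+1) /wallis big_ord_recr /=.
  rewrite -/(wallis R N) En; transitivity
    ((n.+1%:R * n%:R * (A (pi / 2) * cosprod x N.+1)) * n.+1%:R ^- 2).
    have dn : d * (1 - x ^+ 2 * n.+1%:R ^- 2) = n.+1%:R ^- 2.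
      rewrite mulrBr mulr1 mulrA dK.
      have : n.+1%:R != 0 :> R by rewrite pnatr_eq0.
      by move: (n.+1%:R : R) => c c0; field.
    by rewrite -[in RHS]dn; ring.
  by rewrite AE /n; field.
Qed.

Lemma cosprod0 N : cosprod 0 N = 1 :> R.
Proof. by apply: big1 => i _; rewrite expr0n mul0r subr0. Qed.

Lemma cosprod_ge0_le1 x N : x ^+ 2 < 1 -> 0 <= cosprod x N <= 1.
Proof.
move=> x1; have f01 (i : 'I_N) : 0 <= 1 - x ^+ 2 * (2 * i).+1%:R ^- 2 <= 1.
  rewrite subr_ge0 lerBlDr lerDl mulr_ge0 ?sqr_ge0 ?invr_ge0 ?exprn_ge0 // andbT.
  rewrite ler_pdivrMr ?exprn_gt0 // mul1r (le_trans (ltW x1)) //.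
  by rewrite -natrX ler1n expn_gt0.
apply/andP; split; first by apply: prodr_ge0 => i _; case/andP: (f01 i).
by apply: Num.Theory.prodr_ile1 => i _; exact: f01.
Qed.

(** With W = I_(2N+3)(0), the error P - C equals (W - I_(2N+3)(x)) P / W. The difference of
    integrals is at most I_(2N+1)(0) - I_(2N+3)(0) = W/(2N+2). *)
Lemma cosprod_bound x N : 0 <= x < 1 ->
  0 <= cosprod x N.+2 - cos (x * (pi / 2)) <= N.+1%:R^-1.
Proof.
move=> /andP[x0 x1].
have xx1 : x ^+ 2 < 1 by rewrite expr_lt1.
have oo1 : 0 ^+ 2 < 1 :> R by rewrite expr0n.
have [A [dA A0 AE]] := wallis_primitive N.+1 xx1.
have [B [dB B0]] := wallis_primitive N.+1 oo1.
have [B' [dB' B'0]] := wallis_primitive N oo1.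
rewrite !cosprod0 !mul0r cos0 !mulr1 => B'E BE.
have /andP[P0 P1] := cosprod_ge0_le1 N.+2 xx1.
set p := pi / 2 in AE BE B'E *; set P := cosprod x N.+2 in AE P0 P1 *.
set C := cos (x * p) in AE *.
have p0 : 0 <= p by rewrite divr_ge0 ?pi_ge0.
have AB : A p <= B p.
  rewrite -subr_ge0; have <- : B 0 - A 0 = 0 by rewrite B0 A0 subrr.
  apply: (@le_is_derive_ge0 (fun t => B t - A t)
    (fun t => (1 - cos (x * t)) * cos t ^+ (2 * N.+1).+1)) => //.
    move=> t; have dAt := dA t; have dBt := dB t; apply: is_derive_eq.
    by rewrite mul0r cos0; ring.
  move=> t /andP[t0 tp]; rewrite mulr_ge0 ?subr_ge0 ?cos_le1 // exprn_ge0 //.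
  by rewrite cos_ge0_pihalf // (ltW tp) andbT (le_trans _ (ltW t0)) // oppr_le0.
(* Compare integrands: 1 - cos(xt) <= (xt)^2/2 and t cos t <= sin t give (1 - cos(xt)) cos^2 t <=
   (x^2/2) sin^2 t, and the factor sin^2 = 1 - cos^2 turns into [B' - B]. *)
have BA : B p - A p <= x ^+ 2 / 2 * (B' p - B p).
  rewrite -subr_ge0.
  have <- : x ^+ 2 / 2 * (B' 0 - B 0) - (B 0 - A 0) = 0.
    by rewrite A0 B0 B'0 subrr mulr0 subrr.
  apply: (@le_is_derive_ge0 (fun t => x ^+ 2 / 2 * (B' t - B t) - (B t - A t))
    (fun t => (x ^+ 2 / 2 * sin t ^+ 2 - (1 - cos (x * t)) * cos t ^+ 2)
              * cos t ^+ (2 * N).+1)) => //.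
    move=> t; have dAt := dA t; have dBt := dB t; have dB't := dB' t.
    apply: is_derive_eq.
    have -> : (2 * N.+1).+1 = (2 + (2 * N).+1)%N by lia.
    rewrite mul0r cos0 !exprD; move: (cos t ^+ (2 * N).+1) => q.
    by rewrite sin2cos2 /GRing.scale /=; field.
  move=> t /andP[t0 tp].
  have ct : 0 <= cos t.
    by rewrite cos_ge0_pihalf // (ltW tp) andbT (le_trans _ (ltW t0)) // oppr_le0.
  rewrite mulr_ge0 ?exprn_ge0 // subr_ge0.
  have cx : 1 - cos (x * t) <= (x * t) ^+ 2 / 2.
    by rewrite cos_ge_quadratic // mulr_ge0 // ltW.
  have tc : (t * cos t) ^+ 2 <= sin t ^+ 2.
    have tct : 0 <= t * cos t by rewrite mulr_ge0 // ltW.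
    have tcs : t * cos t <= sin t by rewrite mul_cos_le_sin // !ltW.
    by rewrite ler_sqr // nnegrE // (le_trans tct).
  apply: le_trans (ler_wpM2r (sqr_ge0 _) cx) _.
  have -> : (x * t) ^+ 2 / 2 * cos t ^+ 2 = x ^+ 2 / 2 * (t * cos t) ^+ 2 by ring.
  by rewrite ler_wpM2l // divr_ge0 // sqr_ge0.
have c0 : 0 < wallis R N.+1 by exact: wallis_gt0.
have cE : wallis R N = wallis R N.+1 * (1 + (2 * N).+2%:R^-1).
  rewrite [in RHS]/wallis big_ord_recr /= -/(wallis R N) -[(2 * N).+3%:R]natr1.
  have : 0 < (2 * N).+2%:R :> R by rewrite ltr0n.
  by move: ((2 * N).+2%:R : R) => a a0; field; rewrite !gt_eqF // addr_gt0.
have key : wallis R N.+1 * (P - C) = (B p - A p) * P.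
  by rewrite mulrBr -AE -BE; ring.
apply/andP; split.
  by rewrite -(pmulr_rge0 _ c0) key mulr_ge0 // subr_ge0.
rewrite -(ler_pM2l c0) key.
apply: (@le_trans _ _ (B' p - B p)).
  have BB : 0 <= B' p - B p.
    by rewrite BE B'E cE mulrDr mulr1 addrAC subrr add0r mulr_ge0 ?ltW ?invr_gt0.
  apply: (@le_trans _ _ (B p - A p)).
    by rewrite ler_piMr // subr_ge0.
  apply: le_trans BA _; rewrite ler_piMl //.
  by rewrite ler_pdivrMr // mul1r (le_trans (ltW xx1)) // ler1n.
rewrite BE B'E cE mulrDr mulr1 addrAC subrr add0r (ler_wpM2l (ltW c0)) //.
by rewrite lef_pV2 ?posrE // ler_nat; lia.
Qed.

Lemma cvg_cosprod x : 0 <= x < 1 ->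
  cosprod x N @[N --> \oo] --> cos (x * (pi / 2)).
Proof.
move=> x01; rewrite -(cvg_shiftn 2).
apply/subr_cvg0.
apply: (@squeeze_cvgr _ _ _ _ (fun=> 0) (fun N => N.+1%:R^-1)).
- by apply: nearW => N; rewrite /= addn2 cosprod_bound.
- exact: cvg_cst.
- exact: cvg_harmonic.
Qed.

End TrigBounds.

(** * Uniqueness of power series coefficients *)

Section PowerSeries.
Variable R : realType.
Implicit Types (a b d : nat -> R) (u : R).

(** The terms at v = e/2 are bounded by some C. At v r with r <= 1/2 the terms after the first sum
    to at most C r/(1 - r) <= 2 C r in absolute value; the whole sum being 0, |d 0| <= 2 C r for all
    such r. *)
Lemma power_series0_coef0 d (e : R) : 0 < e ->
    (forall u, 0 < u < e -> series (fun k => d k * u ^+ k) @ \oo --> (0 : R)) ->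
  d 0%N = 0.
Proof.
move=> e0 d0; pose v := e / 2.
have v0 : 0 < v by rewrite divr_gt0.
have ve : v < e by rewrite ltr_pdivrMr // ltr_pMr // ltr1n.
have [C C0 dC] : exists2 C, 0 <= C & forall k, `|d k * v ^+ k| <= C.
  have /cvgP/cvg_series_cvg_0/cvgP/cvg_seq_bounded : 
    series (fun k => d k * v ^+ k) @ \oo --> (0 : R) by apply: d0; rewrite v0.
  move=> [M [_ Mb]]; exists (`|M| + 1) => [|k]; first by rewrite addr_ge0.
  by apply: Mb => //; rewrite (le_lt_trans (ler_norm M)) // ltrDl.
have dr (r : R) : 0 < r <= 2^-1 -> `|d 0%N| <= C * 2 * r.
  move=> /andP[r0 r2]; have ur : 0 < v * r < e.
    rewrite mulr_gt0 //= (le_lt_trans _ ve) // ler_piMr ?(ltW v0) //.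
    by rewrite (le_trans r2) // invf_le1 // ler1n.
  pose S := series (fun k => d k * (v * r) ^+ k).
  have S0 : `|S n.+1| @[n --> \oo] --> (0 : R).
    by rewrite -(normr0 R); apply: cvg_norm; rewrite (cvg_shiftS S); exact: d0.
  rewrite -[leLHS]subr0 -(cvg_lim _ S0) // lerBlDl -lerBlDr.
  apply: limr_ge; first exact: cvgP S0.
  apply: nearW => M /=; rewrite lerBlDr.
  rewrite /S /series /= big_nat_recl // expr0 mulr1.
  set T := \sum_(0 <= i < M) _.
  have TC : `|T| <= C * 2 * r.
    apply: (@le_trans _ _ (\sum_(0 <= i < M) C * r * r ^+ i)).
      apply: le_trans (ler_norm_sum _ _ _) _; apply: ler_sum => i _.
      rewrite exprMn mulrA normrM [`|r ^+ _|]ger0_norm ?exprn_ge0 ?(ltW r0) //.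
      rewrite [r ^+ _]exprS mulrA; apply: ler_wpM2r.
        by rewrite exprn_ge0 // ltW.
      by apply: ler_wpM2r (dC _); rewrite ltW.
    rewrite -mulr_sumr mulrAC; apply: ler_wpM2r; first exact: ltW.
    apply: ler_wpM2l => //.
    have r1 : 0 < 1 - r by rewrite subr_gt0 (le_lt_trans r2) // invf_lt1 // ltr1n.
    have : (1 - r) * \sum_(0 <= i < M) r ^+ i <= 1.
      have := subrX1 r M; rewrite -(big_mkord xpredT (fun i => r ^+ i)) => rM.
      have -> : (1 - r) * \sum_(0 <= i < M) r ^+ i = 1 - r ^+ M.
        by rewrite -[1 - r ^+ M]opprB rM; ring.
      by rewrite gerBl exprn_ge0 // ltW.
    by rewrite -ler_pdivlMl // => /le_trans; apply; rewrite mulr1 -[leRHS]invrK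
      lef_pV2 ?posrE ?invr_gt0 //; lra.
  rewrite -[X in `|X| <= _](addrK T).
  by apply: le_trans (ler_normB _ _) _; rewrite lerD2l.
apply/eqP; rewrite -normr_le0 leNgt; apply/negP => d00.
have C2 : 0 < C * 2 + 1 by rewrite ltr_wpDl // mulr_ge0.
(* Chosen so that (2C + 1) r <= |d 0|/2, against |d 0| <= 2 C r. *)
pose r := Order.min 2^-1 (`|d 0%N| / 2 / (C * 2 + 1)).
have r0 : 0 < r.
  by rewrite lt_min invr_gt0 ltr0n /=; apply: divr_gt0 => //; apply: divr_gt0.
have := dr r; rewrite r0 /r ge_min lexx => /(_ isT).
rewrite -/r leNgt => /negP; apply.
have : r <= `|d 0%N| / 2 / (C * 2 + 1) by rewrite ge_min lexx orbT.
rewrite ler_pdivlMr // => rd; lra.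
Qed.

(** The difference series sums to 0; its constant term vanishes, and division by u shifts the
    coefficients for the induction. *)
Lemma power_series_uniq a b (e : R) : 0 < e ->
    (forall u, 0 < u < e -> exists2 l : R,
       series (fun k => a k * u ^+ k) @ \oo --> l &
       series (fun k => b k * u ^+ k) @ \oo --> l) ->
  a =1 b.
Proof.
move=> e0 ab.
suff d0 n d : (forall u, 0 < u < e ->
    series (fun k => d k * u ^+ k) @ \oo --> (0 : R)) -> d n = 0.
  move=> n; apply/eqP; rewrite -subr_eq0; apply/eqP.
  apply: (d0 n (fun k => a k - b k)) => u /ab[l al bl].
  have -> : series (fun k => (a k - b k) * u ^+ k) =
      series (fun k => a k * u ^+ k) \- series (fun k => b k * u ^+ k).
    apply/funext => M; rewrite /series /= -sumrB.
    by apply: eq_bigr => i _; rewrite mulrBl.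
  by rewrite -(subrr l); exact: cvgB al bl.
elim: n d => [|n IHn] d dS; first exact: power_series0_coef0 e0 dS.
apply: (IHn (fun k => d k.+1)) => u ue.
have u0 : u != 0 by case/andP: ue => /gt_eqF ->.
have d00 := power_series0_coef0 e0 dS.
pose S := series (fun k => d k * u ^+ k).
have S1 : S n.+1 @[n --> \oo] --> (0 : R) by rewrite (cvg_shiftS S); exact: dS.
have -> : series (fun k => d k.+1 * u ^+ k) = fun M => u^-1 * S M.+1.
  apply/funext => M; rewrite /S /series /= big_nat_recl // d00 mul0r add0r.
  by rewrite mulr_sumr; apply: eq_bigr => i _; rewrite exprS; field.
by rewrite -(mulr0 u^-1); apply: cvgM S1; exact: cvg_cst.
Qed.

End PowerSeries.

(** * Generating functions and Euler numbers *)

Section HsymSeries.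
Variables (R : realType) (a : nat -> R).
Hypothesis a0 : forall i, 0 <= a i.

Lemma nondecreasing_hsym_series N u : 0 <= u ->
  nondecreasing_seq (series (fun k => hsym a N k * u ^+ k)).
Proof.
move=> u0; apply/nondecreasing_seqP => M.
by rewrite /series /= big_nat_recr // lerDl mulr_ge0 ?hsym_ge0 ?exprn_ge0.
Qed.

(** Adding a variable gives T_(M+1) = S_(M+1) + a_N u T_M for the partial sums. Monotonicity turns
    this into a bound on T_M, hence convergence, and the limit solves t = L + a_N u t. *)
Lemma cvg_hsym_series N u : 0 <= u -> (forall i, a i * u < 1) ->
  series (fun k => hsym a N k * u ^+ k) @ \oo --> \prod_(i < N) (1 - a i * u)^-1.
Proof.
move=> u0 au; elim: N => [|N IHN].
  rewrite big_ord0 -cvg_shiftS; apply: cvg_near_cst; apply: nearW => M.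
  rewrite /series /= big_nat_recl //= mul1r expr0 big1 ?addr0 //.
  by move=> i _; rewrite mul0r.
set S := series _ in IHN; set L := \prod_(i < N) _ in IHN.
set T := series _.
have TE M : T M.+1 = S M.+1 + a N * u * T M.
  rewrite /T /S /series /= !big_nat_recl // !hsym0 -addrA mulr_sumr -big_split.
  congr (_ + _); apply: eq_bigr => i _.
  by rewrite hsymS exprS /=; ring.
have nd := nondecreasing_hsym_series _ u0.
have d0 : 0 < 1 - a N * u by rewrite subr_gt0.
have SL M : S M <= L.
  by have := nondecreasing_cvgn_le (nd N) (cvgP _ IHN) M; rewrite (cvg_lim _ IHN).
have TL M : T M <= L / (1 - a N * u).
  rewrite ler_pdivlMr //.
  have : T M <= T M.+1 by apply: nd.
  by rewrite TE; have := SL M.+1; lra.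
have cT : cvgn T.
  apply: nondecreasing_is_cvgn; first exact: nd.
  by exists (L / (1 - a N * u)) => _ [M _ <-].
have T1 : T M.+1 @[M --> \oo] --> L + a N * u * limn T.
  under eq_fun do rewrite TE.
  apply: cvgD; first by rewrite (cvg_shiftS S).
  by apply: cvgM => //; exact: cvg_cst.
rewrite (cvg_shiftS T) in T1.
have tE : limn T = L + a N * u * limn T := (cvg_lim (@Rhausdorff R) T1).
rewrite big_ord_recr /= -/L; suff -> : L / (1 - a N * u) = limn T by [].
apply: (mulIf (lt0r_neq0 d0)).
by rewrite mulfVK ?lt0r_neq0 // mulrBr mulr1 {1}tE; ring.
Qed.

End HsymSeries.

(** * The coefficients of sec(pi x/2) *)

Section OddSquares.
Variable R : realType.

Definition inv_odd_sqr (i : nat) : R := (2 * i).+1%:R ^- 2.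
Let y := inv_odd_sqr.

Let y0 i : 0 <= y i.
Proof. by rewrite invr_ge0 exprn_ge0. Qed.

Let y_le1 i : y i <= 1.
Proof. by rewrite invf_le1 ?exprn_gt0 // -natrX ler1n expn_gt0. Qed.

Let S N x := series (fun k => hsym y N k * (x ^+ 2) ^+ k).

Section Fixed.
Variable x : R.
Hypothesis x01 : 0 <= x < 1.

Let c := cos (x * (pi / 2)).

Let c_gt0 : 0 < c.
Proof.
case/andP: x01 => x0 x1; have p0 : 0 < pi / 2 :> R by rewrite divr_gt0 ?pi_gt0.
apply: cos_gt0_pihalf; rewrite gtr_pMl // x1 andbT.
by rewrite (lt_le_trans _ (mulr_ge0 x0 (ltW p0))) // oppr_lt0.
Qed.

Let cvgS N : S N x @ \oo --> (cosprod x N)^-1.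
Proof.
case/andP: x01 => x0 x1.
have -> : (cosprod x N)^-1 = \prod_(i < N) (1 - y i * x ^+ 2)^-1.
  by rewrite /cosprod -prodfV; apply: eq_bigr => i _; rewrite mulrC.
apply: cvg_hsym_series => // [|i]; first exact: sqr_ge0.
by rewrite (le_lt_trans (ler_wpM2r (sqr_ge0 _) (y_le1 i))) // mul1r expr_lt1.
Qed.

Let cvg_cosprodV : (cosprod x N)^-1 @[N --> \oo] --> c^-1.
Proof. by apply: cvgV; [rewrite lt0r_neq0 | exact: cvg_cosprod]. Qed.

Let cosprod_ge N : c <= cosprod x N.
Proof.
case/andP: x01 => x0 x1.
rewrite /c -(cvg_lim _ (cvg_cosprod x01)) //.
apply: nonincreasing_cvgn_ge; last exact: cvgP (cvg_cosprod x01).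
apply/nonincreasing_seqP => n; rewrite [leLHS]big_ord_recr /=.
have xx1 : x ^+ 2 < 1 by rewrite expr_lt1.
have /andP[P0 _] := cosprod_ge0_le1 n xx1.
by rewrite ler_piMr // lerBlDr lerDl mulr_ge0 ?sqr_ge0 ?invr_ge0 ?exprn_ge0.
Qed.

(** Uniform in N and M, which permits the later interchange of limits: partial sums stay below the
    inverse of [cosprod x N], and [c] bounds these products from below. *)
Let S_le N M : S N x M <= c^-1.
Proof.
have nd := @nondecreasing_hsym_series R y y0 N (x ^+ 2) (sqr_ge0 _).
have := nondecreasing_cvgn_le nd (cvgP _ (@cvgS N)) M.
rewrite (cvg_lim _ (@cvgS N)) // => /le_trans; apply.
by rewrite lef_pV2 ?posrE // (lt_le_trans c_gt0).
Qed.

(** A single term of a nonnegative series is at most its partial sum; dividing by x^(2k) bounds h_k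
    uniformly in N. *)
Lemma cvg_hsym_term k : 0 < x -> cvgn (fun N => hsym y N k).
Proof.
move=> x0; apply: nondecreasing_is_cvgn; first exact: nondecreasing_hsym.
exists (c^-1 / (x ^+ 2) ^+ k) => _ [N _ <-].
rewrite ler_pdivlMr ?exprn_gt0 //; apply: le_trans (S_le N k.+1).
rewrite /S /series /= big_nat_recr //= lerDr sumr_ge0 // => i _.
by rewrite mulr_ge0 ?hsym_ge0 ?exprn_ge0 ?(ltW x0).
Qed.

Lemma cvg_lim_hsym_series : 0 < x ->
  series (fun k => limn (fun N => hsym y N k) * (x ^+ 2) ^+ k) @ \oo --> c^-1.
Proof.
move=> x0; set T := series _.
have ST M : S N x M @[N --> \oo] --> T M.
  rewrite /S /T /series /=; apply: cvg_big => [|k _].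
    exact: add_continuous.
  by apply: cvgM; [exact: cvg_hsym_term | exact: cvg_cst].
have h0 k : 0 <= limn (fun N => hsym y N k).
  by apply: limr_ge; [exact: cvg_hsym_term | apply: nearW => N; exact: hsym_ge0].
have ndT : nondecreasing_seq T.
  apply/nondecreasing_seqP => M.
  by rewrite /T /series /= big_nat_recr // lerDl mulr_ge0 // exprn_ge0 // sqr_ge0.
have T_le M : T M <= c^-1.
  by rewrite -(cvg_lim _ (ST M)) //; apply: limr_le;
    [exact: cvgP (ST M) | apply: nearW => N; exact: S_le].
have cT : cvgn T.
  by apply: nondecreasing_is_cvgn => //; exists c^-1 => _ [M _ <-].
suff -> : c^-1 = limn T by [].
apply/eqP; rewrite eq_le; apply/andP; split; last first.
  by apply: limr_le => //; exact: nearW.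
(* S N x M <= T M because each h_k grows with the number of variables; letting M and then N tend to
   infinity gives 1/c <= lim T. *)
rewrite -(cvg_lim _ cvg_cosprodV) //; apply: limr_le.
  exact: cvgP cvg_cosprodV.
apply: nearW => N; rewrite -(cvg_lim _ (@cvgS N)) //.
apply: ler_lim => //; first exact: cvgP (@cvgS N).
apply: nearW => M; rewrite -(cvg_lim _ (ST M)) //.
apply: (@nondecreasing_cvgn_le _ (fun N => S N x M)); last exact: cvgP (ST M).
apply/nondecreasing_seqP => n; apply: ler_sum => i _.
apply: ler_wpM2r; first by rewrite exprn_ge0 // sqr_ge0.
by have /nondecreasing_seqP := nondecreasing_hsym y0 i; apply.
Qed.

End Fixed.

Lemma cvg_hsym_euler (E : nat -> R) k : is_euler_numbers E ->
  hsym y N k @[N --> \oo] -->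
    (-1) ^+ k * E (2 * k)%N / (2 * k)`!%:R * (pi / 2) ^+ (2 * k).
Proof.
move=> hE; have p0 : 0 < pi / 2 :> R by rewrite divr_gt0 ?pi_gt0.
(* Existence of the limit needs just one point of (0, 1). *)
have half : 0 <= (2^-1 : R) < 1 by lra.
have hk := @cvg_hsym_term 2^-1 half k.
suff <- : limn (fun N => hsym y N k) =
    (-1) ^+ k * E (2 * k)%N / (2 * k)`!%:R * (pi / 2) ^+ (2 * k).
  by apply: hk; lra.
move: hE => /nbhs_ballP[d /= d0 dE].
(* For x < e the Euler product converges (x < 1) and the secant expansion holds at x pi/2 (below d).
   Coefficients are compared in the variable u = x^2, hence the radius e^2. *)
pose e := Order.min 1 (d / (pi / 2)).
have e0 : 0 < e by rewrite lt_min ltr01 divr_gt0.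
apply: (@power_series_uniq R (fun k => limn (fun N => hsym y N k))
  (fun k => (-1) ^+ k * E (2 * k)%N / (2 * k)`!%:R * (pi / 2) ^+ (2 * k))
  (e ^+ 2)); first by rewrite exprn_gt0.
move=> u /andP[u0 ue]; pose x := Num.sqrt u.
have xu : x ^+ 2 = u by rewrite sqr_sqrtr // ltW.
have x0 : 0 < x by rewrite sqrtr_gt0.
have xe : x < e.
  by rewrite -[ltRHS]ger0_norm ?(ltW e0) // -sqrtr_sqr ltr_sqrt // exprn_gt0.
have x1 : 0 <= x < 1 by rewrite (ltW x0) (lt_le_trans xe) // ge_min lexx.
exists (cos (x * (pi / 2)))^-1; first by rewrite -xu; exact: cvg_lim_hsym_series.
have -> :
    (fun j => (-1) ^+ j * E (2 * j)%N / (2 * j)`!%:R * (pi / 2) ^+ (2 * j) * u ^+ j)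
    = (fun j => (-1) ^+ j * E (2 * j)%N / (2 * j)`!%:R * (x * (pi / 2)) ^+ (2 * j)).
  by apply/funext => j; rewrite -xu -exprM (exprMn _ x) [RHS]mulrA; exact: mulrAC.
apply: dE; rewrite /ball /= sub0r normrN ger0_norm; last by rewrite mulr_ge0 // ltW.
by rewrite -ltr_pdivlMr // (lt_le_trans xe) // ge_min lexx orbT.
Qed.

End OddSquares.

(** * Roots of unity and complex combinations *)

Section ComplexSums.
Variable R : realType.

Lemma sum_mul_realC (I : Type) (s : seq I) (P : pred I) (Z : I -> R[i])
    (r : I -> R) :
  \sum_(i <- s | P i) Z i * (r i)%:C =
  (\sum_(i <- s | P i) complex.Re (Z i) * r i)
    +i* (\sum_(i <- s | P i) complex.Im (Z i) * r i).
Proof.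
elim/big_rec3: _ => // i a b c _ ->; case: (Z i) => u v.
by simpc.
Qed.

(** Limits are taken in R on real and imaginary parts separately; the imaginary part is 0 for every
    N, hence also in the limit. *)
Lemma cvg_complex_comb (I : finType) (P : pred I) (Z : I -> R[i])
    (r : I -> nat -> R) (l : I -> R) (f : nat -> R) :
    (forall i, r i N @[N --> \oo] --> l i) ->
    (forall N, (f N)%:C = \sum_(i | P i) Z i * (r i N)%:C) ->
  exists2 t : R, f @ \oo --> t & t%:C = \sum_(i | P i) Z i * (l i)%:C.
Proof.
move=> rl fE.
have cvg_comb (w : I -> R) :
    \sum_(i | P i) w i * r i N @[N --> \oo] --> \sum_(i | P i) w i * l i.
  apply: cvg_big => [|i _]; first exact: add_continuous.
  by apply: cvgM => //; exact: cvg_cst.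
have fRI N : f N = \sum_(i | P i) complex.Re (Z i) * r i N /\
    \sum_(i | P i) complex.Im (Z i) * r i N = 0.
  by have := fE N; rewrite sum_mul_realC => -[-> <-].
exists (\sum_(i | P i) complex.Re (Z i) * l i).
  rewrite (_ : f = fun N => \sum_(i | P i) complex.Re (Z i) * r i N) //.
  by apply/funext => N; case: (fRI N).
rewrite sum_mul_realC; congr (_ +i* _).
rewrite -(cvg_lim (@Rhausdorff R) (cvg_comb (fun i => complex.Im (Z i)))).
under eq_fun => N do rewrite (fRI N).2.
by rewrite lim_cst.
Qed.

Definition cis (t : R) : R[i] := cos t +i* sin t.

Lemma cisX t n : cis t ^+ n = cis (t * n%:R).
Proof.
elim: n => [|n IHn]; first by rewrite expr0 mulr0 /cis cos0 sin0.
rewrite exprS IHn /cis -natr1 mulrDr mulr1 cosD sinD; simpc.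
by congr (_ +i* _); ring.
Qed.

(** By the double-angle formula, cos t = 1 would force sin(t/2) = 0, while 0 < t/2 < pi. *)
Lemma cis_eq1 t : 0 < t < 2 * pi -> cis t != 1.
Proof.
move=> /andP[t0 t2]; apply/eqP => -[cost _].
have tE : t = (t / 2) *+ 2 by rewrite -mulr_natr divfK.
have : 0 < sin (t / 2).
  by rewrite sin_gt0_pi // divr_gt0 //= ltr_pdivrMr // mulrC.
have := cos2Dsin2 (t / 2); move: cost; rewrite {1}tE cos_mulr2n => c2 cs s0; nra.
Qed.

Lemma cis_prim_root m : (0 < m)%N -> m.-primitive_root (cis (2 * pi / m%:R)).
Proof.
move=> m0; have mr0 : 0 < m%:R :> R by rewrite ltr0n.
rewrite /primitive_root_of_unity m0; apply/forallP => i.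
rewrite unity_rootE cisX; case: (ltngtP i.+1 m) => [im|mi|im].
- apply/eqP/negbTE/cis_eq1; rewrite !mulr_gt0 ?invr_gt0 ?pi_gt0 //=.
  rewrite -mulrA gtr_pMr ?mulr_gt0 ?pi_gt0 //.
  by rewrite mulrC ltr_pdivrMr // mul1r ltr_nat.
- by have := ltn_ord i; rewrite ltnNge -ltnS mi.
- have mE : 2 * pi / m%:R * m%:R = pi *+ 2 :> R.
    by rewrite divfK ?lt0r_neq0 // mulrC mulr_natr.
  by rewrite im mE /cis cos2pi sin2pi !eqxx.
Qed.

Lemma cexp_root m j n :
  cexp ((0 +i* (2 * pi)) / m%:R * j%:R * n%:R : R[i]) =
  (cis (2 * pi / m%:R) ^+ j) ^+ n.
Proof.
rewrite !cisX.
have -> : (0 +i* (2 * pi)) / m%:R * j%:R * n%:R =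
    0 +i* (2 * pi / m%:R * j%:R * n%:R) :> R[i].
  have natC k : k%:R = (k%:R)%:C :> R[i] by rewrite rmorph_nat.
  by rewrite !natC -fmorphV; simpc.
by rewrite /cexp /= expR0 mul1r.
Qed.

End ComplexSums.

Theorem theorem2p12 (R : realType) (E : nat -> R) (hE : is_euler_numbers E)
  (m k : nat) (hm : (0 < m)%N) (hk : (0 < k)%N) :
  tstar R (nseq_tuple k (2 * m)%N) \is a fin_num /\
  (fine (tstar R (nseq_tuple k (2 * m)%N)))%:C =
    ((-1) ^+ (m * k) / ((2 * m * k)`!)%:R * (pi / 2) ^+ (2 * m * k))%:C *
    \sum_(n : {ffun 'I_m -> 'I_(m * k).+1} | (\sum_(j < m) n j == m * k)%N)
      (multinom (2 * m * k) (fun j : 'I_m => 2 * n j)%N)%:R *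
      \prod_(j < m)
        (cexp ((0 +i* (2 * pi)) / m%:R * j%:R * (n j)%:R) * (E (2 * n j)%N)%:C).
Proof.
pose z := cis (2 * pi / m%:R : R).
pose e i : R := (-1) ^+ i * E (2 * i)%N / (2 * i)`!%:R * (pi / 2) ^+ (2 * i).
pose h (n : {ffun 'I_m -> 'I_(m * k).+1}) N :=
  \prod_(j < m) hsym (@inv_odd_sqr R) N (n j).
(* [hsym_prim] over R[i] for finitely many variables (2i+1)^(-2), whose m-th powers are the
   (2i+1)^(-2m). *)
have hC N : (hsym (fun i => (2 * i).+1%:R ^- (2 * m)) N k : R)%:C =
    \sum_(n : {ffun 'I_m -> 'I_(m * k).+1} | (\sum_(j < m) n j == m * k)%N)
      \prod_(j < m) (z ^+ j) ^+ n j * (h n N)%:C.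
  rewrite hsym_morph.
  have -> : real_complex R \o (fun i => (2 * i).+1%:R ^- (2 * m)) =
      (fun i => (real_complex R \o @inv_odd_sqr R) i ^+ m).
    apply/funext => i; rewrite /inv_odd_sqr /= -[RHS]rmorphXn /=.
    by rewrite exprVn -exprM.
  rewrite (hsym_prim (cis_prim_root R hm)); apply: eq_bigr => n _.
  congr (_ * _); rewrite rmorph_prod; apply: eq_bigr => j _.
  by rewrite hsym_morph.
have he n : h n N @[N --> \oo] --> \prod_(j < m) e (n j).
  apply: cvg_big => [|j _]; first exact: mul_continuous.
  exact: cvg_hsym_euler.
have [t ht tE] := cvg_complex_comb he hC.
rewrite (tstar_nseq ht); split => //=; rewrite tE mulr_sumr.
apply: eq_bigr => n /eqP nE.
have n2 : (\sum_(j < m) 2 * n j = 2 * m * k)%N by rewrite -big_distrr /= nE mulnA.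
rewrite [\prod_(j < m) (cexp _ * _)]big_split /=.
rewrite (mulrCA _ (\prod_(j < m) cexp _)) [RHS]mulrCA; congr (_ * _).
  by apply: eq_bigr => j _; rewrite cexp_root.
have -> : (multinom (2 * m * k) (fun j : 'I_m => 2 * n j)%N)%:R =
    ((2 * m * k)`!%:R * \prod_(j < m) (2 * n j)`!%:R^-1 : R)%:C :> R[i].
  by rewrite -multinomE // rmorph_nat.
rewrite -rmorph_prod -!rmorphM; congr (_%:C).
(* The exponents of -1 and of pi/2 add up to mk and 2mk; the (2mk)! of the multinomial cancels
   against the prefactor. *)
rewrite {1}/e !big_split /= -!expr_sum n2 nE.
have f0 : (2 * m * k)`!%:R != 0 :> R by rewrite pnatr_eq0 -lt0n fact_gt0.
move: (\prod_(j < m) E _) (\prod_(j < m) (2 * _)`!%:R^-1) => u v.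
by field.
Qed.
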